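(* Let $N\ge2$ and $q\in(0,1]$ be fixed. For any policy $\pi$, at most one of the following two facts holds (asymptotics as $T\to\infty$): 1. there is a constant $a>0$ (independent of $T$) such that $M^\pi\le a\sqrt T$ almost surely; 2. $\mathbb{E}[Gap^\pi(T)]\in o(\sqrt T)$.
   Context: Balls-into-bins model: $T$ balls are sequentially allocated into $N\ge 2$ initially empty bins. In each period $t\in\{1,\dots,T\}$ a ball arrives; it has a preferred bin $P(t)$ drawn uniformly at random from $\{1,\dots,N\}$, and it is flexible ($f(t)=1$) with probability $q\in(0,1]$, otherwise $f(t)=0$. All draws are independent across periods and of each other. A policy $\pi$ (which may depend on $T$) is a non-anticipating rule determining $\omega^\pi(t)\in\{0,1\}$ (whether to exert flexibility in period $t$) from the numbers of balls in the bins. If $f(t)\omega^\pi(t)=1$, a flex set $\mathcal F(t)$ of two distinct bins is drawn uniformly at random and the ball is put in the bin of $\mathcal F(t)$ with the smaller current load (ties broken in favour of the smallest index). If $f(t)\omega^\pi(t)=0$ the ball is put in $P(t)$. Let $x_i^\pi(t)$ be the load of bin $i$ at the end of period $t$, $x_i^\pi(0)=0$, $Gap^\pi(t)=\max_{i}x_i^\pi(t)-t/N$, and $M^\pi=\sum_{t=1}^T f(t)\omega^\pi(t)$ the number of flex throws. *)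

(* Defs.v *)
From HB Require Import structures.
From mathcomp Require Import all_boot all_order all_algebra finmap.
From mathcomp Require Import all_classical all_reals all_analysis.

Set Implicit Arguments.
Unset Strict Implicit.
Unset Printing Implicit Defensive.

Import Order.TTheory GRing.Theory Num.Theory.
Import numFieldNormedType.Exports.

Local Open Scope classical_set_scope.
Local Open Scope ring_scope.

(** * Probability *)

(* The sigma-algebra generated by a variable with values in a finite type
   (equipped with the discrete sigma-algebra). *)
Definition events {Omega : Type} {T : finType} (X : Omega -> T) :
  set (set Omega) := [set X @^-1` B | B in [set: set T]].

Definition mutually_independent d (Omega : measurableType d) (R : realType)
    (Pr : probability Omega R) (I : choiceType) (A : I -> set (set Omega)) :=
  forall (J : {fset I}) (E : I -> set Omega),
    (forall i, i \in J -> A i (E i)) ->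
    (Pr (\bigcap_(i in [set` J]) E i) = \prod_(i <- J) Pr (E i))%E.

Definition uniformly_distributed d (Omega : measurableType d) (R : realType)
    (Pr : probability Omega R) (T : finType) (X : Omega -> T) :=
  forall v : T, Pr (X @^-1` [set v]) = ((#|T|%:R)^-1)%:E.

(** * The random draws *)

(* Bins are numbered from 0 to N - 1. *)
Definition flex_set (N : nat) := {F : {set 'I_N} | #|F| == 2}.

(* Periods are numbered from 1; the draws of index 0 are never used.
   A flex set is drawn in every period, but it is only consulted by the
   dynamics when the ball is a flex throw. *)
Record draws (N : nat) (Omega : Type) := Draws {
  preferred : nat -> Omega -> 'I_N;
  flexible : nat -> Omega -> bool;
  flexset : nat -> Omega -> flex_set N }.

(* All the draws as one family: three copies of the set of periods. *)
Definition draw_events N (Omega : Type) (D : draws N Omega)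
    (i : nat + nat + nat) : set (set Omega) :=
  match i with
  | inl (inl t) => events (preferred D t)
  | inl (inr t) => events (flexible D t)
  | inr t => events (flexset D t)
  end.

Definition balls_into_bins_draws d (Omega : measurableType d) (R : realType)
    (Pr : probability Omega R) (N : nat) (q : R) (D : draws N Omega) :=
  [/\ forall i, draw_events D i `<=` measurable,
      mutually_independent Pr (draw_events D),
      forall t, uniformly_distributed Pr (preferred D t),
      forall t, Pr (flexible D t @^-1` [set true]) = q%:E &
      forall t, uniformly_distributed Pr (flexset D t)].

(** * Policies and dynamics *)

Definition loads (N : nat) := {ffun 'I_N -> nat}.

(* The decision omega(t), as a function of the past load vectors
   [:: x(t-1); ...; x(0)] (latest first). The list has length t, so the rule
   may also depend on the period. *)
Definition policy (N : nat) := seq (loads N) -> bool.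

(* The bin of F with the smallest load, ties broken in favour of the smallest
   index. Such a bin always exists: the default i0 is never returned. *)
Definition least_loaded N (i0 : 'I_N) (x : loads N) (F : flex_set N) : 'I_N :=
  odflt i0 [pick i in val F |
    [forall j in val F, (x i < x j)%N || (x i == x j) && (i <= j)%N]].

Definition put_ball N (x : loads N) (b : 'I_N) : loads N :=
  [ffun i => (x i + (i == b))%N].

Section Dynamics.
Variables (N : nat) (Omega : Type) (pol : policy N) (D : draws N Omega).

Definition next_load (t : nat) (w : Omega) (past : seq (loads N)) : loads N :=
  let x := head [ffun=> 0%N] past in
  put_ball x (if flexible D t w && pol past
              then least_loaded (preferred D t w) x (flexset D t w)
              else preferred D t w).

(* [:: x(t); ...; x(0)] *)
Fixpoint load_history (t : nat) (w : Omega) : seq (loads N) :=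
  if t is s.+1 then
    let past := load_history s w in next_load t w past :: past
  else [:: [ffun=> 0%N]].

Definition load (t : nat) (w : Omega) : loads N :=
  head [ffun=> 0%N] (load_history t w).

(* omega(t), for t >= 1 *)
Definition exerts (t : nat) (w : Omega) : bool := pol (load_history t.-1 w).

Definition flex_throws (T : nat) (w : Omega) : nat :=
  (\sum_(1 <= t < T.+1) (flexible D t w && exerts t w))%N.

Definition gap (R : realType) (t : nat) (w : Omega) : R :=
  (\max_(i < N) load t w i)%N%:R - t%:R / N%:R.

End Dynamics.

(* Main.v *)
(* A flex throw changes the bin of a single ball, so bin i ends with at least
   Y_i - M balls, where Y_i counts the periods t <= T with P(t) = i. If
   M <= a sqrt T almost surely, then the gap, which is never negative, is at
   least sqrt T as soon as Y_i >= T/N + (a+1) sqrt T. This event has probability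
   bounded below uniformly in T: tilt the uniform law of each P(t) to
   w = (1-eta)/N + eta [b = i], with eta of order 1/sqrt T. Under the tilted
   product law W the event has probability at least 3/4 by Chebyshev, while the
   second moment of the density of W with respect to the uniform law stays
   bounded, so the event keeps a positive probability under the uniform law. *)
Require Import Defs.
From HB Require Import structures.
From mathcomp Require Import all_boot all_order all_algebra finmap.
From mathcomp Require Import all_classical all_reals all_analysis.
From mathcomp Require Import measurable_realfun ring lra.

Set Implicit Arguments.
Unset Strict Implicit.
Unset Printing Implicit Defensive.

Import Order.TTheory GRing.Theory Num.Theory.
Import numFieldNormedType.Exports.

Local Open Scope classical_set_scope.
Local Open Scope ring_scope.

(** * Anticoncentration of bin counts under the uniform product law *)

(** Variance of a sum of independent centred variables: each term of the expanded square factorizes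
    over coordinates, and the off-diagonal ones vanish because [g] has mean zero under [w]. *)
Lemma product_weight_variance (R : comPzRingType) (I B : finType) (w g : B -> R) :
  \sum_b w b = 1 -> \sum_b w b * g b = 0 ->
  \sum_(v : {ffun I -> B}) (\prod_i w (v i)) * (\sum_i g (v i)) ^+ 2 =
  #|I|%:R * \sum_b w b * g b ^+ 2.
Proof.
move=> w1 wg0.
(* Factor of coordinate [k] in the term of indices [i] and [j]; for [i = j = k] it carries [g b]
   twice. *)
pose F (i j k : I) b := w b * (if k == i then g b else 1) * (if k == j then g b else 1).
have E (v : {ffun I -> B}) : (\prod_i w (v i)) * (\sum_i g (v i)) ^+ 2 =
    \sum_i \sum_j \prod_k F i j k (v k).
  rewrite expr2 big_distrlr /= mulr_sumr; apply: eq_bigr => i _.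
  rewrite mulr_sumr; apply: eq_bigr => j _.
  by rewrite !big_split /= -!big_mkcond /= !big_pred1_eq mulrA.
rewrite (eq_bigr _ (fun v _ => E v)) exchange_big /=.
transitivity (\sum_(i : I) \sum_b w b * g b ^+ 2); last first.
  by rewrite big_const iter_addr_0 mulr_natl.
apply: eq_bigr => i _; rewrite exchange_big /= (bigD1 i) //= [X in _ + X]big1.
  rewrite addr0 -(bigA_distr_bigA (F i i)) (bigD1 i) //= [X in _ * X]big1.
    by rewrite mulr1; apply: eq_bigr => b _; rewrite /F eqxx expr2 mulrA.
  by move=> k /negPf ki; rewrite -[RHS]w1; apply: eq_bigr => b _; rewrite /F ki !mulr1.
move=> j ji; rewrite -(bigA_distr_bigA (F i j)) (bigD1 i) //=.
rewrite [X in X * _](_ : _ = 0) ?mul0r // -[RHS]wg0; apply: eq_bigr => b _.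
by rewrite /F eqxx eq_sym (negPf ji) mulr1.
Qed.

(** The sum is the uniform probability that bin [i0] is preferred unusually often; [delta] is fixed
    before [T] and [i0]. *)
Lemma uniform_count_anticoncentration (R : realType) (N : nat) (C : R) :
  (2 <= N)%N -> 0 <= C ->
  exists2 delta : R, 0 < delta &
    forall (T : nat) (i0 : 'I_N), 2 * (C + 2) <= Num.sqrt T%:R ->
    delta <= \sum_(v : {ffun 'I_T -> 'I_N} |
        T%:R / N%:R + C * Num.sqrt T%:R <= (\sum_t (v t == i0))%N%:R)
      N%:R^-1 ^+ T.
Proof.
(* With [eta = h / sqrt T], the tilt raises the mean count by [(1 - 1/N) * h * sqrt T]. As [N >= 2],
   this is at least [(C + 2) * sqrt T], which leaves a margin of [2 * sqrt T] for Chebyshev. *)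
move=> N2 C0; set h := 2 * (C + 2).
have h0 : 0 < h by rewrite /h; lra.
pose K : R := expR (N%:R * h ^+ 2).
have K0 : 0 < K by exact: expR_gt0.
exists (2 * K)^-1; first by rewrite invr_gt0; lra.
move=> T i0; set s := Num.sqrt T%:R => hs.
have s0 : 0 < s by exact: lt_le_trans h0 hs.
have sT : s ^+ 2 = T%:R by rewrite sqr_sqrtr.
pose n : R := N%:R.
have n2 : 2 <= n by rewrite (ler_nat _ 2).
have n0 : n != 0 by rewrite gt_eqF //; lra.
pose eta := h / s.
have eta0 : 0 <= eta by rewrite divr_ge0 // ltW.
have eta1 : eta <= 1 by rewrite ler_pdivrMr // mul1r.
have etas : eta * s = h by rewrite /eta divfK // gt_eqF.
(* The uniform weights tilted towards i0, with mean shift of order eta. *)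
pose w (b : 'I_N) : R := (1 - eta) / n + eta * (b == i0)%:R.
have w0 b : 0 <= w b.
  by rewrite addr_ge0 ?mulr_ge0 ?invr_ge0 ?ler0n //; lra.
have sumi0 (c : R) : \sum_(b < N) c * (b == i0)%:R = c.
  rewrite (bigD1 i0) //= eqxx mulr1 big1 ?addr0 // => b /negPf ->.
  by rewrite mulr0.
have sumc (c : R) : \sum_(b < N) c = c * n.
  by rewrite big_const card_ord iter_addr_0 mulr_natr.
have w1 : \sum_b w b = 1.
  by rewrite big_split /= sumc sumi0 divfK // subrK.
pose p := (1 - eta) / n + eta.
have w1le b : w b <= 1 by rewrite -w1 (bigD1 b) //= lerDl sumr_ge0.
have pi0 : w i0 = p by rewrite /w eqxx mulr1.
pose g (b : 'I_N) : R := (b == i0)%:R - p.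
have wg0 : \sum_b w b * g b = 0.
  under eq_bigr do rewrite /g mulrBr.
  rewrite sumrB -mulr_suml w1 mul1r (bigD1 i0) //= eqxx mulr1 pi0 big1 ?addr0 ?subrr //.
  by move=> b /negPf ->; rewrite mulr0.
have wg2 : \sum_b w b * g b ^+ 2 <= 1.
  rewrite -[leRHS]w1; apply: ler_sum => b _; rewrite ler_piMr //.
  have := w0 i0; have := w1le i0; rewrite pi0 /g => p1 p0.
  by case: (b == i0); rewrite /=; nra.
pose W (v : {ffun 'I_T -> 'I_N}) := \prod_t w (v t).
have W0 v : 0 <= W v by apply: prodr_ge0.
have W1 : \sum_v W v = 1.
  by rewrite -(bigA_distr_bigA (fun=> w)) big1.
have Wg2 : \sum_v W v * (\sum_t g (v t)) ^+ 2 <= s ^+ 2.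
  by rewrite product_weight_variance // card_ord sT ler_piMr.
(* Second moment of the density of [W] with respect to the uniform law. Each coordinate contributes
   [1 + (n - 1) * eta ^+ 2], at most [expR (n * eta ^+ 2)], and [T * eta ^+ 2 = h ^+ 2]. *)
have W2 : n ^+ T * \sum_v W v ^+ 2 <= K.
  have -> : \sum_v W v ^+ 2 = (\sum_b w b ^+ 2) ^+ T.
    under eq_bigr do rewrite /W -prodrXl.
    by rewrite -(bigA_distr_bigA (fun _ b => w b ^+ 2)) prodr_const card_ord.
  rewrite -exprMn.
  have -> : n * \sum_b w b ^+ 2 = 1 + (n - 1) * eta ^+ 2.
    rewrite (eq_bigr (fun b => ((1 - eta) / n) ^+ 2 +
        (2 * ((1 - eta) / n) * eta + eta ^+ 2) * (b == i0)%:R)); last first.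
      by move=> b _; rewrite /w; case: (b == i0); rewrite /=; ring.
    by rewrite big_split /= sumc sumi0; field.
  have -> : K = expR (n * eta ^+ 2) ^+ T.
    rewrite -expRM_natl /K -sT; congr expR.
    by rewrite [RHS]mulrCA -exprMn [s * _]mulrC etas.
  apply: lerXn2r; rewrite ?nnegrE ?expR_ge0 //.
    by rewrite addr_ge0 // mulr_ge0 ?sqr_ge0 //; lra.
  apply: le_trans (expR_ge1Dx _); rewrite lerD2l ler_wpM2r ?sqr_ge0 //; lra.
set A := (X in \sum_(v | X v) _).
have gE (v : {ffun 'I_T -> 'I_N}) : \sum_t g (v t) = (\sum_t (v t == i0))%N%:R - s ^+ 2 * p.
  by rewrite sumrB sumr_const card_ord natr_sum sT mulr_natl.
(* Chebyshev: outside [A] the centred count is below [- 2 * s], while its variance is at most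
   [s ^+ 2]. *)
have WnA : \sum_(v | ~~ A v) W v <= 4^-1.
  have W4 v : ~~ A v -> W v <= (4 * s ^+ 2)^-1 * (W v * (\sum_t g (v t)) ^+ 2).
    rewrite -ltNge gE -sT -/n => Av; rewrite mulrCA ler_peMr //.
    rewrite ler_pdivlMl ?mul1r; last by nra.
    rewrite mulr1.
    have : s ^+ 2 / n + (C + 2) * s <= s ^+ 2 * p.
      have -> : s ^+ 2 * p = s ^+ 2 / n + (1 - n^-1) * (eta * s) * s.
        by rewrite /p; field.
      rewrite etas /h lerD2l ler_wpM2r ?(ltW s0) //.
      have : n^-1 <= 2^-1 by rewrite lef_pV2 ?posrE //; lra.
      move: (n^-1) => u u2.
      by have := mulr_ge0 C0 (etrans (subr_ge0 _ _) u2); lra.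
    by move=> sp; nra.
  apply: le_trans (ler_sum _ W4) _.
  rewrite -mulr_sumr mulrC ler_pdivrMr; last by nra.
  rewrite mulrA mulVf // mul1r; apply: le_trans _ Wg2.
  rewrite [leRHS](bigID A) /= lerDr sumr_ge0 // => v _.
  by rewrite mulr_ge0 ?sqr_ge0.
have WA : 3 / 4 <= \sum_(v | A v) W v.
  by move: W1; rewrite (bigID A) /=; lra.
have nT0 : 0 < n ^+ T by rewrite exprn_gt0 //; lra.
(* AM-GM: W <= alpha W^2 + 1 / (4 alpha) with alpha = n^T / (2 K) *)
have amgm v : W v <= (2 * K)^-1 * (n ^+ T * W v ^+ 2) + K / 2 * n^-1 ^+ T.
  rewrite exprVn -subr_ge0.
  have -> : (2 * K)^-1 * (n ^+ T * W v ^+ 2) + K / 2 * (n ^+ T)^-1 - W v =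
      (n ^+ T * W v - K) ^+ 2 / (2 * K * n ^+ T).
    by field; rewrite !gt_eqF.
  by rewrite divr_ge0 ?sqr_ge0 // !mulr_ge0 // ltW.
(* By [W2] the quadratic terms total at most 1/2; against the lower bound 3/4 of [WA], the uniform
   mass of [A] is at least [(2 * K)^-1]. *)
have WA2 : \sum_(v | A v) W v <= 2^-1 + K / 2 * \sum_(v | A v) n^-1 ^+ T.
  apply: le_trans (ler_sum _ (fun v _ => amgm v)) _.
  rewrite big_split /= -!mulr_sumr lerD2r mulrC ler_pdivrMr; last by lra.
  rewrite mulrA mulVf // mul1r; apply: le_trans _ W2.
  rewrite ler_wpM2l // ?[leRHS](bigID A) /= ?lerDl ?sumr_ge0 // ?ltW // => v _.
  exact: sqr_ge0.
rewrite invfM -[_^-1 * K^-1]mulr1 -/n.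
rewrite -mulrA mulrC -mulrA ler_pdivrMl //.
lra.
Qed.

(** * Pathwise bounds on loads and gap *)

Section LoadBounds.
Variables (N : nat) (Omega : Type) (pol : policy N) (D : draws N Omega).

Lemma loadS (T : nat) (w : Omega) :
  load pol D T.+1 w = put_ball (load pol D T w)
    (if flexible D T.+1 w && exerts pol D T.+1 w
     then least_loaded (preferred D T.+1 w) (load pol D T w) (flexset D T.+1 w)
     else preferred D T.+1 w).
Proof. by []. Qed.

Lemma flex_throwsS (T : nat) (w : Omega) :
  flex_throws pol D T.+1 w =
  (flex_throws pol D T w + (flexible D T.+1 w && exerts pol D T.+1 w))%N.
Proof. by rewrite /flex_throws big_nat_recr. Qed.

Lemma sum_load (T : nat) (w : Omega) : (\sum_i load pol D T w i = T)%N.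
Proof.
elim: T => [|T IH]; first by rewrite big1 // => i _; rewrite /load ffunE.
rewrite loadS; set b := (X in put_ball _ X).
under eq_bigr do rewrite ffunE.
rewrite big_split /= IH (bigD1 b) //= eqxx big1 ?addn1 // => i /negPf ->.
by [].
Qed.

(** By induction: an ordinary throw raises the count and the load together, and a ball diverted from
    [i] is paid for by the flex throw that diverted it. *)
Lemma preferred_count_le (T : nat) (w : Omega) (i : 'I_N) :
  (\sum_(t < T) (preferred D t.+1 w == i) <=
   load pol D T w i + flex_throws pol D T w)%N.
Proof.
elim: T => [|T IH]; first by rewrite big_ord0.
rewrite big_ord_recr /= flex_throwsS loadS ffunE.
case: ifP => _; last by rewrite addn0 addnAC leq_add // eq_sym.
apply: leq_trans (leq_add IH (leq_b1 _)) _.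
by rewrite addnACA leq_add2l addn1.
Qed.

Lemma gap_ge (R : realType) (T : nat) (w : Omega) (i : 'I_N) :
  (\sum_(t < T) (preferred D t.+1 w == i))%N%:R - (flex_throws pol D T w)%:R
    - T%:R / N%:R <= gap pol D R T w.
Proof.
rewrite /gap lerD2r lerBlDr -natrD ler_nat.
apply: leq_trans (preferred_count_le T w i) _; rewrite leq_add2r.
exact: (leq_bigmax i).
Qed.

(** The maximal load is at least the average load. *)
Lemma gap_ge0 (R : realType) (T : nat) (w : Omega) :
  (0 < N)%N -> 0 <= gap pol D R T w.
Proof.
move=> N0; rewrite /gap subr_ge0 ler_pdivrMr ?ltr0n // -natrM ler_nat.
rewrite -[leqLHS](sum_load T w) mulnC -[X in (X * _)%N]card_ord -sum_nat_const.
by apply: leq_sum => i _; exact: (leq_bigmax i).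
Qed.

Lemma gap_le (R : realType) (T : nat) (w : Omega) : gap pol D R T w <= T%:R.
Proof.
rewrite /gap lerBlDr ler_wpDr ?divr_ge0 // ler_nat.
apply/bigmax_leqP => i _; rewrite -[leqRHS](sum_load T w).
by rewrite (bigD1 i) //= leq_addr.
Qed.

End LoadBounds.

(** * Measurability and the law of the preferred bins *)

Section MeasureFacts.
Variables (d : measure_display) (Omega : measurableType d).

Lemma preimage_measurable_countable (C : countType) (f : Omega -> C) :
  (forall c, measurable (f @^-1` [set c])) -> forall B, measurable (f @^-1` B).
Proof.
move=> mf B.
have -> : f @^-1` B = \bigcup_c (if c \in B then f @^-1` [set c] else set0).
  apply/seteqP; split=> [w Bw|w [c _]].
    by exists (f w) => //; rewrite mem_set.
  by case: ifP => // /set_mem Bc /= ->.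
by apply: countable_bigcupT_measurable => // c; case: ifP.
Qed.

Variables (R : realType) (Pr : probability Omega R).

Lemma mutually_independent_ord (I : choiceType) (A : I -> set (set Omega))
    (n : nat) (k : 'I_n -> I) (E : 'I_n -> set Omega) :
  mutually_independent Pr A -> injective k -> (forall j, A (k j) (E j)) ->
  Pr (\bigcap_j E j) = (\prod_j Pr (E j))%E.
Proof.
move=> indep kinj AE.
(* Independence is stated for events indexed by all of [I], so [E] is carried along [k] and
   completed by [setT]. *)
pose F i := if [pick j | k j == i] is Some j then E j else setT.
have FE j : F (k j) = E j.
  by rewrite /F; case: pickP => [j' /eqP /kinj -> //|/(_ j)]; rewrite eqxx.
pose J := [fset k j | j in 'I_n]%fset.
have -> : \bigcap_j E j = \bigcap_(i in [set` J]) F i.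
  apply/seteqP; split=> w Ew.
    by move=> i /= /imfsetP[j _ ->]; rewrite FE; exact: Ew.
  by move=> j _; rewrite -FE; apply: Ew; apply/imfsetP; exists j.
rewrite indep; last by move=> i /imfsetP[j _ ->]; rewrite FE.
rewrite big_imfset /=; last by move=> ? ? _ _ /kinj.
under eq_bigr do rewrite FE.
apply: perm_big; apply: uniq_perm; rewrite ?index_enum_uniq ?enum_uniq //.
by move=> j; rewrite mem_enum mem_index_enum.
Qed.

Lemma probability_finite_preimage (V : finType) (Y : Omega -> V) (B : pred V) :
  (forall v, measurable (Y @^-1` [set v])) ->
  Pr (Y @^-1` [set v | B v]) = (\sum_(v | B v) Pr (Y @^-1` [set v]))%E.
Proof.
move=> mY.
have -> : Y @^-1` [set v | B v] = \bigcup_(v in [set` enum B]) Y @^-1` [set v].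
  apply/seteqP; split=> [w Bw|w [v + /= ->]].
    by exists (Y w); rewrite //= mem_enum.
  by rewrite /= mem_enum.
rewrite measure_fin_bigcup //; last by move=> v w _ _ [x [/= -> ->]].
by rewrite -fsbig_seq ?enum_uniq // big_enum.
Qed.

End MeasureFacts.

Lemma uniform_sequence_preimage (d : measure_display) (Omega : measurableType d)
    (R : realType) (Pr : probability Omega R) (N : nat) (q : R)
    (D : draws N Omega) (T : nat) (v : {ffun 'I_T -> 'I_N}) :
  balls_into_bins_draws Pr q D ->
  let Y w := [ffun t : 'I_T => preferred D t.+1 w] in
  measurable (Y @^-1` [set v]) /\ Pr (Y @^-1` [set v]) = (N%:R^-1 ^+ T)%:E.
Proof.
move=> [mD indep unif _ _] Y.
have YE : Y @^-1` [set v] = \bigcap_(t : 'I_T) preferred D t.+1 @^-1` [set v t].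
  apply/seteqP; split=> w /= => [<- t _|Yw]; first by rewrite /= ffunE.
  by apply/ffunP => t; rewrite ffunE; exact: Yw.
have ev (t : 'I_T) : draw_events D (inl (inl t.+1)) (preferred D t.+1 @^-1` [set v t]).
  by exists [set v t].
split.
  by rewrite YE; apply: fin_bigcap_measurable => // t _; exact: mD (ev t).
rewrite YE (mutually_independent_ord indep _ ev); last by move=> t u [] /val_inj.
under eq_bigr do rewrite unif card_ord.
by rewrite prodEFin prodr_const card_ord.
Qed.

Section LoadMeasurable.
Variables (d : measure_display) (Omega : measurableType d) (R : realType).
Variables (Pr : probability Omega R) (N : nat) (q : R) (D : draws N Omega).

(** The policy reads the whole history, so the induction is on histories rather than loads. Each new
    history is a function of the old one and the current draws, a variable with countably many
    values, so its atoms suffice. *)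
Lemma load_history_measurable (pol : policy N) (T : nat)
    (B : set (seq (loads N))) :
  balls_into_bins_draws Pr q D -> measurable (load_history pol D T @^-1` B).
Proof.
move=> [mD _ _ _ _].
elim: T B => [|T IH] B; first by rewrite preimage_cst; case: ifP.
pose Z w := (load_history pol D T w, preferred D T.+1 w, flexible D T.+1 w,
             flexset D T.+1 w).
pose step (z : seq (loads N) * 'I_N * bool * flex_set N) :=
  let: (past, p, f, F) := z in let x := head [ffun=> 0%N] past in
  put_ball x (if f && pol past then least_loaded p x F else p) :: past.
rewrite (_ : load_history pol D T.+1 @^-1` B = Z @^-1` (step @^-1` B)) //.
apply: preimage_measurable_countable => -[[[past p] f] F].
have -> : Z @^-1` [set (past, p, f, F)] =
    load_history pol D T @^-1` [set past] `&` preferred D T.+1 @^-1` [set p] `&`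
    flexible D T.+1 @^-1` [set f] `&` flexset D T.+1 @^-1` [set F].
  apply/seteqP; split=> w; rewrite /Z /=; first by move=> [-> -> -> ->].
  by move=> [[[-> ->] ->] ->].
do ![apply: measurableI].
- exact: IH.
- by apply: (mD (inl (inl T.+1))); exists [set p].
- by apply: (mD (inl (inr T.+1))); exists [set f].
- by apply: (mD (inr T.+1)); exists [set F].
Qed.

Lemma gap_measurable (pol : policy N) (T : nat) :
  balls_into_bins_draws Pr q D -> measurable_fun setT (gap pol D R T).
Proof.
move=> hD _ B _; rewrite setTI.
pose phi (past : seq (loads N)) : R :=
  (\max_(i < N) head [ffun=> 0%N] past i)%N%:R - T%:R / N%:R.
exact: (load_history_measurable _ _ (phi @^-1` B) hD).
Qed.

End LoadMeasurable.

Theorem proposition7 (R : realType) (N : nat) (q : R) (hN : (2 <= N)%N)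
    (hq : 0 < q <= 1) (d : measure_display) (Omega : measurableType d)
    (Pr : probability Omega R) (D : draws N Omega)
    (hD : balls_into_bins_draws Pr q D) (pol : nat -> policy N) :
  ~ ((exists2 a : R, 0 < a & forall T : nat,
        {ae Pr, forall w, (flex_throws (pol T) D T w)%:R <= a * Num.sqrt T%:R})
     /\
     (fun T : nat => fine ('E_Pr[gap (pol T) D R T])%E)
       =o_\oo (fun T : nat => Num.sqrt T%:R : R)).
Proof.
have N0 : (0 < N)%N by exact: leq_trans hN.
move=> [[a a0 flex_le] /eqoP gap_o].
have a1 : 0 <= a + 1 by lra.
have [delta delta0 anti] := uniform_count_anticoncentration hN a1.
(* The little-o bound is used with constant [delta / 2], against an expected gap of at least
   [delta * sqrt T]. *)
have d2 : 0 < delta / 2 by lra.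
have [M _ MP] := gap_o _ d2.
have [T MT hT] : exists2 T, (M <= T)%N & 2 * (a + 1 + 2) <= Num.sqrt T%:R :> R.
  have [k hk] : exists k : nat, 2 * (a + 1 + 2) < k%:R.
    by exists (Num.bound (2 * (a + 1 + 2))); apply: archi_boundP; lra.
  (* A perfect square, whose root is the natural number [maxn M k]. *)
  exists (maxn M k ^ 2)%N.
    rewrite (leq_trans (leq_maxl M k)) // -mulnn.
    by case: (maxn M k) => // m; rewrite leq_pmulr.
  by rewrite natrX sqrtr_sqr ger0_norm // (le_trans (ltW hk)) // ler_nat leq_maxr.
pose i0 : 'I_N := Ordinal N0.
set s := Num.sqrt T%:R in hT.
have s0 : 0 < s by apply: lt_le_trans hT; lra.
pose Y w := [ffun t : 'I_T => preferred D t.+1 w].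
(* Of the excess [(a + 1) * s], flex throws can cancel [a * s], leaving a gap of at least [s]. *)
pose A (v : {ffun 'I_T -> 'I_N}) :=
  T%:R / N%:R + (a + 1) * s <= (\sum_t (v t == i0))%N%:R.
pose B := Y @^-1` [set v | A v].
have mY v : measurable (Y @^-1` [set v]).
  by have [] := uniform_sequence_preimage v hD.
have mB : measurable B by exact: preimage_measurable_countable.
have PB : (delta%:E <= Pr B)%E.
  rewrite /B probability_finite_preimage //.
  rewrite (eq_bigr (fun=> (N%:R^-1 ^+ T)%:E)); last first.
    by move=> v _; have [] := uniform_sequence_preimage v hD.
  by rewrite sumEFin lee_fin; exact: anti.
have mg := (measurable_EFinP _ _).2 (gap_measurable (pol T) T hD).
have Ege : ((s * delta)%:E <= 'E_Pr[gap (pol T) D R T])%E.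
  apply: (@le_trans _ _ (\int[Pr]_w (s * \1_B w)%:E)%E).
    rewrite (integralZl_indic measurableT (fun=> B)) //; last by move=> /(lt_trans s0); rewrite ltxx.
    by rewrite integral_indic // setIT EFinM lee_wpmul2l // lee_fin ltW //.
  rewrite unlock; apply: ae_ge0_le_integral => //.
  - by move=> w _; rewrite lee_fin mulr_ge0 // ltW.
  - by apply/measurable_EFinP; apply: measurable_funM => //; exact: measurable_indic.
  - by move=> w _; rewrite lee_fin gap_ge0.
  (* The flex bound holds only almost everywhere: there the gap is at least [s] on [B], and it is
     nonnegative elsewhere. *)
  apply: filterS (flex_le T) => w Mw _; rewrite lee_fin indicE.
  case: (boolP (w \in B)) => [/set_mem Bw|_]; last by rewrite mulr0 gap_ge0.
  rewrite mulr1; apply: le_trans (gap_ge (pol T) D R T w i0).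
  have Aw : T%:R / N%:R + (a + 1) * s <=
      (\sum_(t < T) (preferred D t.+1 w == i0))%N%:R.
    by move: Bw; rewrite /B /= /A /Y; under eq_bigr do rewrite ffunE.
  move: Mw Aw; rewrite -/s; clear; lra.
have Ele : ('E_Pr[gap (pol T) D R T] <= T%:R%:E)%E.
  rewrite -(expectation_cst Pr T%:R) unlock; apply: ge0_le_integral => //.
  - by move=> w _; rewrite lee_fin gap_ge0.
  - by apply/measurable_EFinP; exact: measurable_cst.
  - by move=> w _; rewrite lee_fin gap_le.
have := MP T MT; apply/negP; rewrite -ltNge.
(* [fine] sends infinite values to 0, so finiteness is required to transfer the lower bound. *)
have Efin : ('E_Pr[gap (pol T) D R T])%E \is a fin_num.
  rewrite fin_numE; apply/andP; split.
    by rewrite gt_eqF // (lt_le_trans _ Ege) // ltNyr.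
  by rewrite lt_eqF // (le_lt_trans Ele) // ltry.
have : s * delta <= fine ('E_Pr[gap (pol T) D R T])%E.
  by rewrite -lee_fin fineK.
move=> sd; apply: lt_le_trans (ler_norm _); apply: lt_le_trans sd.
rewrite ger0_norm ?(ltW s0) // mulrC ltr_pM2l //; lra.
Qed.
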